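(* Define $\mathcal{A}_*(T,\Delta):=T\bigl[\cosh(\Delta/T)-1\bigr]$ for $T>0$ and $\Delta\in\mathbb{R}$. Then: (i) $\mathcal{A}_*$ is the perspective transform $(T,\Delta)\mapsto T f(\Delta/T)$ of $f(u)=\cosh(u)-1$, and is jointly convex on $(0,\infty)\times\mathbb{R}$; (ii) for each fixed $T>0$, $\mathcal{A}_*$ is strictly convex in $\Delta$; (iii) $\mathcal{A}_*(\lambda T,\lambda\Delta)=\lambda\,\mathcal{A}_*(T,\Delta)$ for every $\lambda>0$; (iv) for each fixed $\Delta$, $\mathcal{A}_*$ is monotone non-increasing in $T$, with $\partial_T\mathcal{A}_*\le 0$ and $\mathcal{A}_*(T,\Delta)\to 0$ as $T\to\infty$.
   Context: The function $\mathcal{A}_*$ is called the minimum-action profile. All notions used are standard. *)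

(* Defs.v *)
From HB Require Import structures.
From mathcomp Require Import all_boot all_order all_algebra.
From mathcomp Require Import all_classical all_reals all_analysis.

Set Implicit Arguments.
Unset Strict Implicit.
Unset Printing Implicit Defensive.

Import Order.TTheory GRing.Theory Num.Theory.
Import numFieldNormedType.Exports.

Local Open Scope classical_set_scope.
Local Open Scope ring_scope.
Local Open Scope convex_scope.

Definition cosh (R : realType) (x : R) : R := (expR x + expR (- x)) / 2.

(* Meaningful for 0 < T only: at T = 0 the division takes its default value. *)
Definition perspective (R : realType) (f : R -> R) (T x : R) : R :=
  T * f (x / T).

Definition min_action (R : realType) (T Delta : R) : R :=
  T * (cosh (Delta / T) - 1).

(* The strict counterpart of [convex_function]. *)
Definition strictly_convex_function (R : numFieldType) (E : lmodType R)
    (E' := convex_lmodType E) (D : set E') (f : E' -> R^o) : Prop :=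
  forall t : {i01 R}, 0 < t%:num -> t%:num < 1 ->
    {in D &, forall x y : E', x != y -> f (x <| t |> y) < f x <| t |> f y}.

(* Main.v *)
(* Since cosh is convex, u |-> cosh u - 1 lies above each of its tangents.
   Taking perspectives, the minimum action lies above the linear forms
   (T, x) |-> T (cosh u - 1 - u sinh u) + x sinh u, with equality exactly on
   the ray x = u T. As a supremum of linear forms it is convex, and the
   T-coefficient of the supporting form, being the T-derivative, is
   nonpositive because the tangent at u lies below cosh - 1 at 0. The same
   inequality gives 0 <= A(T, x) <= x sinh (x / T), hence the limit. *)
Require Import Defs.
From HB Require Import structures.
From mathcomp Require Import all_boot all_order all_algebra.
From mathcomp Require Import all_classical all_reals all_analysis.
From mathcomp Require Import ring lra.

Import Order.TTheory GRing.Theory Num.Theory.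
Import numFieldNormedType.Exports.

Local Open Scope classical_set_scope.
Local Open Scope ring_scope.

Section Cosh.
Context {R : realType}.
Implicit Types u v : R.

Definition sinh u : R := (expR u - expR (- u)) / 2.

Lemma cosh0 : cosh (0 : R) = 1.
Proof. by rewrite /cosh oppr0 expR0; field. Qed.

Lemma sinh0 : sinh 0 = 0.
Proof. by rewrite /sinh oppr0 expR0 subrr mul0r. Qed.

(** Factoring [expR u] out of [expR v] reduces this to [1 + w <= expR w] with [w = v - u]. *)
Lemma expR_ge_tangent u v : expR u * (1 + (v - u)) <= expR v.
Proof.
by rewrite -[in leRHS](subrK u v) expRD mulrC ler_pM2r ?expR_gt0// expR_ge1Dx.
Qed.

Lemma expR_gt_tangent u v : v != u -> expR u * (1 + (v - u)) < expR v.
Proof.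
move=> vu; rewrite -[in ltRHS](subrK u v) expRD mulrC ltr_pM2r ?expR_gt0//.
by rewrite expR_gt1Dx ?subr_eq0.
Qed.

(** Average of the tangent inequalities of the exponential at [u] and at [- u]. *)
Lemma cosh_ge_tangent u v : cosh u + sinh u * (v - u) <= cosh v.
Proof.
have := expR_ge_tangent u v; have := expR_ge_tangent (- u) (- v).
by rewrite /cosh /sinh; lra.
Qed.

(** In the same average, strictness of the inequality at [u] is enough. *)
Lemma cosh_gt_tangent u v : v != u -> cosh u + sinh u * (v - u) < cosh v.
Proof.
move=> /expR_gt_tangent; have := expR_ge_tangent (- u) (- v).
by rewrite /cosh /sinh; lra.
Qed.

Lemma cosh_ge1 u : 1 <= cosh u.
Proof. by have := cosh_ge_tangent 0 u; rewrite cosh0 sinh0 mul0r addr0. Qed.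

(** The tangent at [u], evaluated at 0. This gives the sign of the [T]-coefficient of every
    supporting form. *)
Lemma cosh_le_mul_sinh u : cosh u - 1 <= u * sinh u.
Proof. by have := cosh_ge_tangent u 0; rewrite cosh0; lra. Qed.

Lemma is_derive_cosh u : is_derive u 1 (@cosh R) (sinh u).
Proof.
rewrite /sinh /cosh; apply: is_derive_eq.
by rewrite /GRing.scale/=; ring.
Qed.

Lemma continuous_sinh : continuous sinh.
Proof.
move=> u; apply: cvgMl; apply: cvgB; first exact: continuous_expR.
apply: continuous_comp; [exact: opp_continuous | exact: continuous_expR].
Qed.

End Cosh.

Section MinAction.
Context {R : realType}.
Implicit Types T S x y u : R.

Definition supporting_form u T x : R :=
  T * (cosh u - 1 - u * sinh u) + x * sinh u.

Lemma min_action_supporting T x :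
  0 < T -> min_action T x = supporting_form (x / T) T x.
Proof.
by move=> T0; rewrite /min_action /supporting_form; field; rewrite gt_eqF.
Qed.

(** Exhibits the form as the perspective of a tangent line, so that comparing it with [min_action]
    reduces to comparing [cosh] with its tangent. *)
Lemma supporting_formE u T x : 0 < T ->
  supporting_form u T x = T * (cosh u + sinh u * (x / T - u) - 1).
Proof. by move=> T0; rewrite /supporting_form; field; rewrite gt_eqF. Qed.

Lemma min_action_ge_supporting u T x :
  0 < T -> supporting_form u T x <= min_action T x.
Proof.
by move=> T0; rewrite supporting_formE// ler_pM2l// lerB// cosh_ge_tangent.
Qed.

Lemma min_action_gt_supporting u T x :
  0 < T -> x / T != u -> supporting_form u T x < min_action T x.
Proof.
move=> T0 xTu; rewrite supporting_formE// ltr_pM2l// ltrBDr subrK.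
exact: cosh_gt_tangent.
Qed.

Lemma supporting_form_conv u (t : R) T S x y :
  supporting_form u (t * T + (1 - t) * S) (t * x + (1 - t) * y) =
  t * supporting_form u T x + (1 - t) * supporting_form u S y.
Proof. by rewrite /supporting_form; ring. Qed.

Lemma min_action_convex : @convex_function R (R^o * R^o)%type
  (`]0, +oo[ `*` [set: R]) (fun p => min_action p.1 p.2).
Proof.
move=> t [T x] [S y]; rewrite !inE /= !in_itv/= !andbT => -[T0 _] [S0 _].
have ts0 : 0 < t%:num * T + (1 - t%:num) * S := convR_gt0 t T0 S0.
rewrite convRE.
(* Convex combinations of pairs are componentwise by conversion. *)
change (min_action (t%:num * T + (1 - t%:num) * S)
                   (t%:num * x + (1 - t%:num) * y) <=
        t%:num * min_action T x + (1 - t%:num) * min_action S y).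
(* The form touching at the combined point splits by linearity, and each part is bounded at its own
   endpoint. *)
rewrite min_action_supporting// supporting_form_conv.
by rewrite lerD// ler_wpM2l ?subr_ge0 ?le1// min_action_ge_supporting.
Qed.

Lemma min_action_strictly_convex T : 0 < T ->
  @strictly_convex_function R R^o [set: R] (min_action T).
Proof.
move=> T0 t t0 t1 x y _ _ xy.
rewrite !convRE.
set z := t%:num * x + (1 - t%:num) * y.
(* Writing the fixed [T] as an average of itself makes the joint linearity of the form
   applicable. *)
have TE : T = t%:num * T + (1 - t%:num) * T by ring.
have -> : min_action T z = t%:num * supporting_form (z / T) T x +
    (1 - t%:num) * supporting_form (z / T) T y.
  by rewrite -supporting_form_conv -TE min_action_supporting.
have t1' : 0 < 1 - t%:num by rewrite subr_gt0.
(* Strictness at [x] suffices: the ratios [x / T] and [z / T] differ, because [x - z] is a nonzero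
   multiple of [x - y]. *)
apply: ltr_leD; last by rewrite ler_pM2l// min_action_ge_supporting.
rewrite ltr_pM2l// min_action_gt_supporting//.
rewrite (can_eq (divfK (lt0r_neq0 T0))) -subr_eq0.
have -> : x - z = (1 - t%:num) * (x - y) by rewrite /z; ring.
by apply: mulf_neq0; [exact: lt0r_neq0 | rewrite subr_eq0].
Qed.

Lemma min_action_scale lambda T x : 0 < lambda ->
  min_action (lambda * T) (lambda * x) = lambda * min_action T x.
Proof.
by move=> l0; rewrite /min_action -mulf_div divff ?gt_eqF// mul1r mulrA.
Qed.

(** The form touching at [(S, x)] has a nonpositive [T]-coefficient, so it can only grow when [S]
    decreases to [T], where it still lies below [min_action]. *)
Lemma min_action_nincr x T S :
  0 < T -> T <= S -> min_action S x <= min_action T x.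
Proof.
move=> T0 TS; have S0 := lt_le_trans T0 TS.
rewrite min_action_supporting//.
apply: le_trans (min_action_ge_supporting (x / S) T x T0).
by rewrite lerD2r ler_wnM2r// subr_le0 cosh_le_mul_sinh.
Qed.

Lemma is_derive_min_action x T : 0 < T ->
  is_derive T 1 (fun S : R => min_action S x)
    (cosh (x / T) - 1 - x / T * sinh (x / T)).
Proof.
move=> T0; have Tn0 : T != 0 by rewrite gt_eqF.
have dV : is_derive T 1 (fun S : R => x / S) (- x / T ^+ 2).
  (* The quotient is differentiated as [x] times the inverse of the identity. *)
  have dTV := @is_deriveV R id T 1 1 Tn0 (is_derive_id _ _).
  by apply: is_derive_eq; rewrite /GRing.scale/=; field.
have dc := @is_derive1_comp _ _ (fun S : R => x / S) _ _ _
  (is_derive_cosh (x / T)) dV.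
rewrite /min_action; apply: is_derive_eq.
by rewrite /GRing.scale/=; field.
Qed.

Lemma min_action_cvg0 x : min_action T x @[T --> +oo] --> (0 : R).
Proof.
apply: (@squeeze_cvgr _ _ _ _ (fun=> 0) (fun T => x * sinh (x / T))).
- near=> T; have T0 : 0 < T by near: T; exact: nbhs_pinfty_gt.
  rewrite mulr_ge0 ?subr_ge0 ?cosh_ge1 ?(ltW T0)//=.
  (* Restoring the factor [T] turns the upper bound into the tangent inequality at [x / T]. *)
  have -> : x * sinh (x / T) = T * (x / T * sinh (x / T)).
    by field; rewrite gt_eqF.
  by rewrite ler_pM2l// cosh_le_mul_sinh.
- exact: cvg_cst.
(* The limit 0 is rewritten as [x * sinh 0], so that continuity of [sinh] and [x / T] tending to 0
   conclude. *)
- rewrite -[X in _ --> X](mulr0 x) -sinh0; apply: cvgMr.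
  apply: continuous_cvg; first exact: continuous_sinh.
  rewrite -[X in _ --> X](mulr0 x); apply: cvgMr.
  apply/gtr0_cvgV0; [exact: nbhs_pinfty_gt | exact: cvg_id].
Unshelve. all: by end_near. Qed.

End MinAction.

Theorem proposition4p16 (R : realType) :
  [/\ (forall T Delta : R, 0 < T ->
         min_action T Delta = perspective (fun u => cosh u - 1) T Delta) /\
      @convex_function R (R^o * R^o)%type (`]0, +oo[ `*` [set: R])
        (fun p => min_action p.1 p.2),
      (forall T : R, 0 < T ->
         @strictly_convex_function R R^o [set: R] (min_action T)),
      (forall lambda T Delta : R, 0 < lambda -> 0 < T ->
         min_action (lambda * T) (lambda * Delta)
         = lambda * min_action T Delta)
    & (forall Delta : R,
         [/\ (forall T1 T2 : R, 0 < T1 -> T1 <= T2 ->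
                min_action T2 Delta <= min_action T1 Delta),
             (forall T : R, 0 < T ->
                derivable (fun S : R => min_action S Delta) T 1 /\
                derive1 (fun S : R => min_action S Delta) T <= 0)
           & min_action T Delta @[T --> +oo] --> (0 : R)])].
Proof.
split.
- split=> [T Delta _ //|]; exact: min_action_convex.
- exact: min_action_strictly_convex.
- by move=> lambda T Delta l0 _; exact: min_action_scale.
- move=> Delta; split; [exact: min_action_nincr| |exact: min_action_cvg0].
  move=> T T0; have dA := is_derive_min_action Delta T T0.
  split; first exact: ex_derive.
  by rewrite derive1E derive_val subr_le0 cosh_le_mul_sinh.
Qed.
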